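(* Suppose $\langle\cdot,\cdot\rangle$ is skew-symmetric and $r\ge 1$. Then $U(r;V)\subseteq\mathrm{End}_k(V)^r$ is a dense open subvariety unless $n=2$ and $r=1$.
   Context: $k$ is an algebraically closed field of characteristic different from $2$; $n,r$ are positive integers; $V=k^n$ is equipped with a nondegenerate bilinear form $\langle\cdot,\cdot\rangle$ (here skew-symmetric, so $n$ is even). $\rho$ is the adjoint involution on $\mathrm{End}_k(V)$, determined by $\langle\rho(A)v,w\rangle=\langle v,Aw\rangle$ for all $v,w\in V$. An $r$-tuple $A_\bullet=(A_1,\dots,A_r)\in\mathrm{End}_k(V)^r$ generates $\mathrm{End}_k(V)$ as an algebra with involution if every $B\in\mathrm{End}_k(V)$ is a noncommutative polynomial over $k$ in the $A_i$ and $\rho(A_i)$. $U(r;V)\subseteq\mathrm{End}_k(V)^r$ is the set of $r$-tuples that generate $\mathrm{End}_k(V)$ as an algebra with involution. $\mathrm{End}_k(V)^r$ is identified with affine space $\mathbb{A}^{n^2r}_k$ with its Zariski topology. *)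

(* Defs.v *)
From HB Require Import structures.
From mathcomp Require Import all_boot all_order all_algebra.
From mathcomp Require Import finmap monalg.
From mathcomp Require Import mpoly.
From mathcomp Require Import boolp classical_sets topology_structure.

Set Implicit Arguments.
Unset Strict Implicit.
Unset Printing Implicit Defensive.

Import GRing.Theory.
Local Open Scope ring_scope.
Local Open Scope classical_set_scope.

(* End_k(V)^r for V = k^n, the space of column vectors.  This is an alias, so
   that the Zariski topology below is not attached to all finite functions. *)
Definition endo_tuple (k : closedFieldType) (n r : nat) : Type :=
  {ffun 'I_r -> 'M[k]_n}.

HB.instance Definition _ k n r := Choice.on (endo_tuple k n r).

Section Zariski.
Variables (k : closedFieldType) (n r : nat).
Implicit Types (A : endo_tuple k n r) (O : set (endo_tuple k n r)).

(* The identification of End_k(V)^r with affine space: the list of all the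
   entries of A_1, ..., A_r. *)
Definition coords A : 'I_(r * (n * n)) -> k :=
  fun j => mxvec (\matrix_(i < r) mxvec (A i)) 0 j.

Definition zero_locus (I : set (mpoly (r * (n * n)) k)) :
    set (endo_tuple k n r) :=
  [set A | forall p, I p -> p.@[coords A] = 0].

Definition zariski_open O := exists I, O = ~` zero_locus I.

Lemma zariski_openT : zariski_open setT.
Proof.
exists [set 1]; rewrite -[LHS]setCK setCT; congr (~` _).
by apply/seteqP; split=> A //= /(_ 1 erefl) /eqP; rewrite meval1 oner_eq0.
Qed.

Lemma zariski_openI : setI_closed zariski_open.
Proof.
move=> _ _ [I ->] [J ->].
exists [set p * q | p in I & q in J]; rewrite -setCU; congr (~` _).
apply/seteqP; split=> A; rewrite /zero_locus /=.
- by move=> [zA|zA] _ [p Ip [q Jq <-]]; rewrite mevalM ?(zA _ Ip) ?(zA _ Jq) ?mul0r ?mulr0.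
- move=> zA; apply: contrapT=> /not_orP[].
  move=> /existsNP[p /not_implyP[Ip /eqP pA]].
  move=> /existsNP[q /not_implyP[Jq /eqP qA]].
  have /eqP := zA (p * q) (ex_intro2 _ _ p Ip (ex_intro2 _ _ q Jq erefl)).
  by rewrite mevalM mulf_eq0 (negPf pA) (negPf qA).
Qed.

Lemma zariski_open_bigU (T : Type) (f : T -> set (endo_tuple k n r)) :
  (forall i, zariski_open (f i)) -> zariski_open (\bigcup_i f i).
Proof.
move=> /choice[I fI]; exists (\bigcup_i I i).
rewrite -[LHS]setCK setC_bigcup; congr (~` _).
apply/seteqP; split=> A; rewrite /zero_locus /=.
- by move=> zA p [i _ Ip]; have := zA i Logic.I; rewrite fI setCK; apply.
- by move=> zA i _; rewrite fI setCK => p Ip; apply: zA; exists i.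
Qed.

HB.instance Definition _ := isOpenTopological.Build (endo_tuple k n r)
  zariski_openT zariski_openI zariski_open_bigU.

Lemma openE_zariski O : open O <-> zariski_open O.
Proof. by []. Qed.

End Zariski.

Section Generation.
Variables (k : closedFieldType) (n r : nat).
Implicit Types (rho : 'M[k]_n -> 'M[k]_n) (A : endo_tuple k n r).

(* For a nondegenerate form there is exactly one such rho. *)
Definition adjoint_involution (form : {skew_symmetric 'cV[k]_n}) rho :=
  forall (B : 'M[k]_n) (v w : 'cV[k]_n), form (rho B *m v) w = form v (B *m w).

(* Noncommutative polynomials in the 2r variables x_i = inl i, y_i = inr i:
   the monoid algebra of the free monoid on these variables. *)
Definition ncpoly := {malg k[{fmonom ('I_r + 'I_r)%type}]}.

(* x_i is sent to A_i and y_i to rho(A_i).  The evaluation mmap of monalg is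
   not available, as 'M[k]_n is a nontrivial ring only for n a successor. *)
Definition nceval rho A (p : ncpoly) : 'M[k]_n :=
  \sum_(w <- monalg.msupp p) monalg.mcoeff w p *:
    \prod_(x <- (w : seq ('I_r + 'I_r)%type))
      match x with inl i => A i | inr i => rho (A i) end.

Definition generates rho A := forall B : 'M[k]_n, exists p, B = nceval rho A p.

End Generation.

Definition U (k : closedFieldType) (n r : nat) (rho : 'M[k]_n -> 'M[k]_n) :
  set (endo_tuple k n r) := [set A | generates rho A].

Arguments U {k n} r rho.

(* Main.v *)
From HB Require Import structures.
Require Import Defs.
From mathcomp Require Import all_boot all_order all_algebra.
From mathcomp Require Import finmap monalg.
From mathcomp Require Import mpoly.
From mathcomp Require Import boolp classical_sets topology_structure.

(** Why the theorem is true.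

    Openness.  A tuple generates exactly when some n^2 words in its letters
    A_i, rho(A_i) are linearly independent (generatesP), that is, when some
    determinant made of the entries of n^2 words does not vanish.  As rho is
    linear, such a determinant is a polynomial in the entries of the A_i
    (word_polynomial), so U is a union of principal open sets.

    Density.  The affine space is irreducible: restricting two polynomials to
    a line through points where they do not vanish gives nonzero univariate
    polynomials, and these have a common non-root (zariski_irreducible).  It
    is therefore enough to exhibit one generating tuple.

    The witness.  V is an orthogonal sum of m hyperbolic planes with bases
    e_i, f_i (symplectic_basis), so n = 2m and End(V) is the algebra of m x m
    matrices over the algebra of 2 x 2 matrices.  Write P_ij for the identity
    block in position (i, j), and N, N' for the two nilpotent 2 x 2 matrix
    units.  The adjoint of P_ij is P_ji, and N, N' placed on the diagonal are
    sent to their opposites.  For m >= 2 put S = P_00 and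
      K = sum_i (P_(i,i+1) - P_(i+1,i)) + N at (0, 0) + N' at (1, 1).
    Then rho(S) = S and rho(K) = - K, so, 2 being invertible, the single
    endomorphism S + K generates S and K.  Compressing K by S isolates N; after
    this, one walks along the path 0 - 1 - 2 - ... to obtain every P_ij, and N'
    on the way (path_nilpotents_generate).  Finally the P_ij, N and N' span all
    blocks, since N and N' generate the 2 x 2 matrices.  For m = 1, N and N'
    are themselves two generating endomorphisms; a single A never generates
    when n = 2, because rho(A) = tr(A) - A commutes with A. *)

Set Implicit Arguments.
Unset Strict Implicit.
Unset Printing Implicit Defensive.
Import GRing.Theory.
Local Open Scope ring_scope.

(** * Symplectic bases and the adjoint involution *)

Section Symplectic.
Variables (k : fieldType) (n : nat) (form : {skew_symmetric 'cV[k]_n}).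
Implicit Types (u v w : 'cV[k]_n) (X Y : 'M[k]_n) (e f : nat -> 'cV[k]_n).

Definition covec w : 'rV[k]_n := \row_j form w (delta_mx j 0).

(** The operator v |-> <w, v> u; the adjoint exchanges u and w up to sign. *)
Definition rank1 u w : 'M[k]_n := u *m covec w.

Lemma covecM w v : covec w *m v = (form w v)%:M.
Proof.
apply/matrixP=> i j; rewrite !ord1 !mxE /=.
rewrite [v in RHS]matrix_sum_delta linear_sum /=; apply: eq_bigr => l _.
by rewrite big_ord1 linearZ /= !mxE mulrC.
Qed.

Lemma rank1_mulv u w v : rank1 u w *m v = form w v *: u.
Proof. by rewrite /rank1 -mulmxA covecM mul_mx_scalar. Qed.

Lemma skewC u v : form u v = - form v u.
Proof. by rewrite hermC expr1 mulN1r. Qed.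

Lemma mx_mulv_inj X Y : (forall v, X *m v = Y *m v) -> X = Y.
Proof.
move=> eqXY; apply/matrixP=> i j.
by have /matrixP/(_ i 0) := eqXY (delta_mx j 0); rewrite -!colE !mxE.
Qed.

Hypothesis hk : 2%N \notin [pchar k].

Lemma form_alt u : form u u = 0.
Proof.
have /eqP := skewC u u; rewrite -subr_eq0 opprK -mulr2n -mulr_natr mulf_eq0.
by move: hk; rewrite inE /= => /negPf->; rewrite orbF => /eqP.
Qed.

Hypothesis hform : nondegenerate form.

Lemma nondegenerate_eq0 v : (forall w, form v w = 0) -> v = 0.
Proof.
move=> v0; apply/eqP; rewrite -memv0 -(eqP hform).
by apply/mem_orthovP => w _.
Qed.

Section Adjoint.
Variables (rho : 'M[k]_n -> 'M[k]_n) .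
Hypothesis (hrho : forall X v w, form (rho X *m v) w = form v (X *m w)).

Lemma adjoint_unique X Y :
  (forall v w, form (Y *m v) w = form v (X *m w)) -> rho X = Y.
Proof.
move=> adjY; apply: mx_mulv_inj => v; apply/eqP; rewrite -subr_eq0; apply/eqP.
by apply: nondegenerate_eq0 => w; rewrite linearBl /= hrho adjY subrr.
Qed.

Lemma adjoint_linear : linear rho.
Proof.
move=> a X Y; apply: adjoint_unique => v w.
rewrite !mulmxDl -!scalemxAl linearDl linearDr linearZl_LR linearZr_LR /=.
by rewrite !hrho.
Qed.

Lemma adjointD X Y : rho (X + Y) = rho X + rho Y.
Proof. by rewrite -[X in LHS]scale1r adjoint_linear scale1r. Qed.

Lemma adjoint0 : rho 0 = 0.
Proof. by apply: (addrI (rho 0)); rewrite -adjointD !addr0. Qed.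

Lemma adjointN X : rho (- X) = - rho X.
Proof. by apply/eqP; rewrite -addr_eq0 -adjointD addNr adjoint0. Qed.

Lemma adjoint_rank1 u w : rho (rank1 u w) = - rank1 w u.
Proof.
apply: adjoint_unique => x y; rewrite mulNmx !rank1_mulv linearNl.
by rewrite linearZl_LR linearZr_LR /= [form x u]skewC mulrN mulrC.
Qed.
End Adjoint.

Definition symplectic_family m e f := forall i j, (i < m)%N -> (j < m)%N ->
  [/\ form (e i) (e j) = 0, form (f i) (f j) = 0
    & form (e i) (f j) = (i == j)%:R].

(** A frame embeds k^2 onto the plane of e_i, f_i; the coframe is the
    orthogonal projection onto that plane, read in coordinates.  The sign comes
    from <f_i, e_i> = - 1. *)
Definition frame e f i : 'M[k]_(n, 1 + 1) := row_mx (e i) (f i).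
Definition coframe e f i : 'M[k]_(1 + 1, n) :=
  col_mx (- covec (f i)) (covec (e i)).

Lemma coframeK m e f i j : symplectic_family m e f -> (i < m)%N -> (j < m)%N ->
  coframe e f i *m frame e f j = (i == j)%:R%:M.
Proof.
move=> fam im jm; have [ee ff ef] := fam i j im jm.
have [_ _ fe] := fam j i jm im.
rewrite /coframe /frame mul_col_row !mulNmx !covecM ee ff ef (skewC (f i)) fe.
rewrite (eq_sym j) !raddf0 [(- _)%:M]raddfN opprK -scalar_mx_block.
by [].
Qed.

(** The functionals <e_i, -> and the vectors f_i are dual to each other, so
    there are at most n of them. *)
Lemma symplectic_family_le m e f : symplectic_family m e f -> (m <= n)%N.
Proof.
move=> fam; pose E := \matrix_(i < m, j < n) covec (e i) 0 j.
pose F := \matrix_(j < n, i < m) f i j 0.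
suff: E *m F = 1%:M by move/mulmx1_min.
apply/matrixP=> i j; rewrite !mxE.
have [_ _ /= <-] := fam i j (ltn_ord i) (ltn_ord j).
rewrite -[form _ _](_ : (covec (e i) *m f j) 0 0 = _); last first.
  by rewrite covecM mxE mulr1n.
by rewrite mxE; apply: eq_bigr => l _; rewrite !mxE.
Qed.

(** The orthogonal projection onto the span of the family; it is the identity
    exactly when the family is a basis. *)
Definition frame_sum m e f := \sum_(i < m) frame e f i *m coframe e f i.

(** If the projection onto the span is not the identity, its complement D has
    a nonzero value u, which is orthogonal to the family; nondegeneracy gives a
    partner of u, and applying D to it makes it orthogonal to the family too
    without changing its pairing with u. *)
Lemma symplectic_extend m e f : symplectic_family m e f ->
  frame_sum m e f != 1%:M ->
  exists e' f', symplectic_family m.+1 e' f'.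
Proof.
(* D is the projection onto the orthogonal complement of the family. *)
move=> fam; rewrite eq_sym -subr_eq0 => D0; set D := _ - _ in D0.
have cD i : (i < m)%N -> coframe e f i *m D = 0.
  move=> im; rewrite mulmxBr mulmx1 mulmx_sumr (bigD1 (Ordinal im)) //=.
  rewrite mulmxA (coframeK fam) // eqxx mul1mx big1 ?addr0 ?subrr // => j ji.
  rewrite mulmxA (coframeK fam) // eq_sym -[j == i :> nat]/(j == Ordinal im).
  by rewrite (negPf ji) raddf0 mul0mx.
have orth i v : (i < m)%N -> form (e i) (D *m v) = 0 /\ form (f i) (D *m v) = 0.
  move=> im; have := cD i im; rewrite /coframe mul_col_mx -[RHS]col_mx0.
  case/eq_col_mx => /eqP; rewrite mulNmx oppr_eq0 => /eqP fD eD.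
  have form0 w : covec w *m D = 0 -> form w (D *m v) = 0.
    move=> wD; have := covecM w (D *m v); rewrite mulmxA wD mul0mx.
    by move/matrixP/(_ 0 0); rewrite !mxE mulr1n => <-.
  by split; apply: form0.
have [u0 Du0] : exists u0, D *m u0 != 0.
  case: (pickP (fun j => D *m delta_mx j 0 != 0 :> 'cV_n)) => [j Dj|D_eq0].
    by exists (delta_mx j 0).
  case/eqP: D0; apply/matrixP=> i j; rewrite mxE.
  by have /negbFE/eqP/matrixP/(_ i 0) := D_eq0 j; rewrite -colE !mxE.
set u := D *m u0 in Du0.
have [v0 uv0] : exists v0, form u v0 != 0.
  apply: contrapT => /forallNP uv; case/eqP: Du0; apply/nondegenerate_eq0 => w.
  by apply/eqP/negPn/negP/uv.
have uDv0 : form u (D *m v0) = form u v0.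
  rewrite mulmxBl mul1mx linearBr /= mulmx_suml linear_sumr /=.
  rewrite big1 ?subr0 // => i _.
  have [eu fu] := orth i u0 (ltn_ord i).
  rewrite -mulmxA /frame /coframe.
  suff uF : covec u *m frame e f i = 0.
    have := covecM u (frame e f i *m (coframe e f i *m v0)).
    by rewrite mulmxA uF mul0mx => /matrixP/(_ 0 0); rewrite !mxE mulr1n => <-.
  by rewrite mul_mx_row !covecM [form u (e i)]skewC [form u (f i)]skewC eu fu
     oppr0 raddf0 row_mx0.
pose v := (form u v0)^-1 *: (D *m v0).
have uv : form u v = 1 by rewrite linearZr_LR /= uDv0 mulVf.
have orthv i : (i < m)%N -> form (e i) v = 0 /\ form (f i) v = 0.
  move=> im; have [ev fv] := orth i v0 im.
  by rewrite !linearZr_LR /= ev fv mulr0.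
exists (fun i => if i == m then u else e i),
  (fun i => if i == m then v else f i).
move=> i j; rewrite !ltnS [(i <= m)%N]leq_eqVlt [(j <= m)%N]leq_eqVlt.
have [-> _|im] /= := eqVneq i m; have [->|jm] /= := eqVneq j m.
- by rewrite !form_alt.
- move=> jm'; have [eu fu] := orth j u0 jm'; have [ev fv] := orthv j jm'.
  by rewrite skewC eu (skewC v) fv (skewC u) fu oppr0.
- move=> im' _; have [eu fu] := orth i u0 im'; have [ev fv] := orthv i im'.
  by rewrite eu fv ev (negPf im).
- by apply: fam.
Qed.

Lemma symplectic_basis : exists m e f,
  symplectic_family m e f /\ frame_sum m e f = 1%:M.
Proof.
apply: contrapT => no_basis.
suff grow m : exists e f, symplectic_family m e f.
  by have [e [f /symplectic_family_le]] := grow n.+1; rewrite ltnn.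
elim: m => [|m [e [f fam]]]; first by exists (fun=> 0), (fun=> 0).
apply: (symplectic_extend fam); apply/eqP => full.
by apply: no_basis; exists m, e, f.
Qed.

End Symplectic.

(** * Block matrix units *)

Section Blocks.
Variables (k : fieldType) (n p m : nat).
Variables (b : nat -> 'M[k]_(n, p)) (c : nat -> 'M[k]_(p, n)).
Hypothesis cb : forall i j, (i < m)%N -> (j < m)%N ->
  c i *m b j = (i == j)%:R%:M.

Definition block i j (X : 'M[k]_p) : 'M[k]_n := b i *m X *m c j.

Lemma block_mul i j h l X Y : (j < m)%N -> (h < m)%N ->
  block i j X *m block h l Y = if h == j then block i l (X *m Y) else 0.
Proof.
move=> jm hm; rewrite /block !mulmxA -(mulmxA _ (c j)) cb // eq_sym.
by case: eqP => _; rewrite ?mulmx1 -?mulmxA // raddf0 mul0mx !mulmx0.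
Qed.

Lemma block_linear i j : linear (block i j).
Proof.
by move=> a X Y; rewrite /block mulmxDr mulmxDl -scalemxAr -scalemxAl.
Qed.

Lemma block_decomposition (X : 'M[k]_n) : \sum_(i < m) b i *m c i = 1%:M ->
  X = \sum_(i < m) \sum_(j < m) block i j (c i *m X *m b j).
Proof.
move=> bc1; rewrite -{1}[X]mulmx1 -{1}[X]mul1mx -bc1 mulmx_suml mulmx_suml.
apply: eq_bigr => i _; rewrite mulmx_sumr; apply: eq_bigr => j _.
by rewrite /block !mulmxA.
Qed.

(** The skew-adjoint operator that moves one step along the path
    0 - 1 - ... - (m - 1). *)
Definition path_op : 'M[k]_n :=
  \sum_(0 <= j < m.-1) (block j j.+1 1%:M - block j.+1 j 1%:M).

Lemma path_opMr i X : (i < m)%N -> path_op *m block i i X =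
  (if (0 < i)%N then block i.-1 i X else 0)
  - (if (i.+1 < m)%N then block i.+1 i X else 0).
Proof.
move=> im; rewrite /path_op mulmx_suml.
pose F j := if (j.+1 == i) then block j i X else 0.
pose H j := if (j == i) then block j.+1 i X else 0.
rewrite (eq_big_nat _ _ (F2 := fun j => F j - H j)); last first.
  move=> j /andP[_ jm]; have jm' : (j.+1 < m)%N by case: (m) jm.
  rewrite mulmxBl !block_mul // ?(ltnW jm') // !mul1mx ![i == _]eq_sym.
  by [].
rewrite sumrB; congr (_ - _); rewrite -big_mkcond /=.
  case: i im {F H} => [|i] im /=; first by rewrite big_pred0.
  rewrite (eq_bigl (fun j => j == i)) // big_nat1_eq /=.
  by rewrite -ltnS (ltn_predK im) im.
rewrite big_nat1_eq /=.
by case: (m) im.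
Qed.

Lemma path_opMl i X : (i < m)%N -> block i i X *m path_op =
  (if (i.+1 < m)%N then block i i.+1 X else 0)
  - (if (0 < i)%N then block i i.-1 X else 0).
Proof.
move=> im; rewrite /path_op mulmx_sumr.
pose F j := if (j == i) then block i j.+1 X else 0.
pose H j := if (j.+1 == i) then block i j X else 0.
rewrite (eq_big_nat _ _ (F2 := fun j => F j - H j)); last first.
  move=> j /andP[_ jm]; have jm' : (j.+1 < m)%N by case: (m) jm.
  by rewrite mulmxBr !block_mul // ?(ltnW jm') // !mulmx1.
rewrite sumrB; congr (_ - _); rewrite -big_mkcond /=.
  by rewrite big_nat1_eq /=; case: (m) im.
case: i im {F H} => [|i] im /=; first by rewrite big_pred0.
rewrite (eq_bigl (fun j => j == i)) // big_nat1_eq /=.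
by rewrite -ltnS (ltn_predK im) im.
Qed.

(* G is a subalgebra, given by its membership predicate. *)
Variable G : 'M[k]_n -> Prop.
Hypothesis (GD : forall a X Y, G X -> G Y -> G (a *: X + Y)).
Hypothesis (GM : forall X Y, G X -> G Y -> G (X *m Y)).

Lemma genB X Y : G X -> G Y -> G (X - Y).
Proof. by move=> GX GY; rewrite -scaleN1r addrC; apply: GD. Qed.

Lemma gen0 X : G X -> G 0.
Proof. by move=> GX; rewrite -(subrr X); apply: genB. Qed.

Lemma genN X : G X -> G (- X).
Proof. by move=> GX; rewrite -sub0r; apply: genB => //; apply: gen0 GX. Qed.

Lemma genD X Y : G X -> G Y -> G (X + Y).
Proof. by move=> GX GY; rewrite -[X]scale1r; apply: GD. Qed.

Lemma gen_sum (I : finType) (F : I -> 'M[k]_n) :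
  G 0 -> (forall i, G (F i)) -> G (\sum_i F i).
Proof. by move=> G0 GF; elim/big_ind: _ => //; apply: genD. Qed.

(** Applying the path operator to P_ii gives P_(i-1,i) - P_(i+1,i), and
    P_(i-1,i) has already been obtained, so an induction along the path reaches
    every position. *)
Lemma path_generates : G path_op -> G (block 0 0 1%:M) -> forall i j,
  (i < m)%N -> (j < m)%N -> G (block i j 1%:M).
Proof.
move=> GP G00.
have step i : (i < m)%N -> [/\ G (block i i 1%:M),
    (0 < i)%N -> G (block i.-1 i 1%:M) & (0 < i)%N -> G (block i i.-1 1%:M)].
  elim: i => [|i IH] im; first by [].
  have im' := ltnW im; have [Gii GNi GiN] := IH im'.
  have Gr : G (block i.+1 i 1%:M).
    rewrite -[block _ _ _]opprK; apply: genN.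
    move: (GM GP Gii) GNi; rewrite path_opMr // im.
    case: ifP => [_ GPi /(_ isT) GNi|_]; last by rewrite sub0r.
    by have := genB GPi GNi; rewrite addrAC subrr add0r.
  have Gl : G (block i i.+1 1%:M).
    move: (GM Gii GP) GiN; rewrite path_opMl // im.
    case: ifP => [_ GPi /(_ isT) GiN|_]; last by rewrite subr0.
    by have := genD GPi GiN; rewrite subrK.
  by split=> [|_|_] //; have := GM Gr Gl; rewrite block_mul ?eqxx ?mulmx1.
have G_0 i : (i < m)%N -> G (block i 0 1%:M).
  elim: i => // i IH im; have [_ _ /(_ isT) /= Gi] := step _ im.
  by have := GM Gi (IH (ltnW im)); rewrite block_mul ?eqxx ?mulmx1 // ltnW.
have G0_ i : (i < m)%N -> G (block 0 i 1%:M).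
  elim: i => // i IH im; have [_ /(_ isT) /= Gi _] := step _ im.
  by have := GM (IH (ltnW im)) Gi; rewrite block_mul ?eqxx ?mulmx1 // ltnW.
move=> i j im jm; have := GM (G_0 i im) (G0_ j jm).
by rewrite block_mul ?eqxx ?mulmx1 // (leq_ltn_trans _ im).
Qed.

End Blocks.

Section BlockGeneration.
Variables (k : fieldType) (n m : nat).
Variables (b : nat -> 'M[k]_(n, 1 + 1)) (c : nat -> 'M[k]_(1 + 1, n)).
Hypothesis cb : forall i j, (i < m)%N -> (j < m)%N ->
  c i *m b j = (i == j)%:R%:M.
Hypothesis bc1 : \sum_(i < m) b i *m c i = 1%:M.
Variable G : 'M[k]_n -> Prop.
Hypothesis (GD : forall a X Y, G X -> G Y -> G (a *: X + Y)).
Hypothesis (GM : forall X Y, G X -> G Y -> G (X *m Y)).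

Local Notation block := (block b c).

Definition upper_nil : 'M[k]_(1 + 1) := block_mx 0 1%:M 0 0.
Definition lower_nil : 'M[k]_(1 + 1) := block_mx 0 0 1%:M 0.

Lemma mul_upper_lower : upper_nil *m lower_nil = block_mx 1%:M 0 0 0.
Proof. by rewrite mulmx_block !mul0mx !mulmx0 mulmx1 !add0r. Qed.

Lemma mul_lower_upper : lower_nil *m upper_nil = block_mx 0 0 0 1%:M.
Proof. by rewrite mulmx_block !mul0mx !mulmx0 mulmx1 !add0r ?addr0. Qed.

Lemma one_upper_lower :
  1%:M = upper_nil *m lower_nil + lower_nil *m upper_nil.
Proof.
by rewrite mul_upper_lower mul_lower_upper add_block_mx !addr0 add0r
  -scalar_mx_block.
Qed.

Lemma mx2_span (X : 'M[k]_(1 + 1)) : exists x y z t,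
  X = x *: (upper_nil *m lower_nil) + (y *: upper_nil
      + (z *: lower_nil + t *: (lower_nil *m upper_nil))).
Proof.
rewrite -[X]submxK [ulsubmx X]mx11_scalar [ursubmx X]mx11_scalar.
rewrite [dlsubmx X]mx11_scalar [drsubmx X]mx11_scalar.
do 4![eexists]; rewrite mul_upper_lower mul_lower_upper !scale_block_mx.
by rewrite !scalemx1 !scaler0 !add_block_mx !addr0 !add0r.
Qed.

(** The P_ij move a diagonal block to any position, so both nilpotents are
    available everywhere; and the nilpotents generate the 2 x 2 matrices. *)
Lemma nilpotents_generate i0 j0 : (i0 < m)%N -> (j0 < m)%N ->
  (forall i j, (i < m)%N -> (j < m)%N -> G (block i j 1%:M)) ->
  G (block i0 i0 upper_nil) -> G (block j0 j0 lower_nil) -> forall X, G X.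
Proof.
move=> im jm G1 GU GL.
have spread h X : (h < m)%N -> G (block h h X) ->
  forall i j, (i < m)%N -> (j < m)%N -> G (block i j X).
  move=> hm GX i j im' jm'; have := GM (GM (G1 i h im' hm) GX) (G1 h j hm jm').
  by rewrite (block_mul cb) // eqxx (block_mul cb) // eqxx mul1mx mulmx1.
have {}GU := spread _ _ im GU; have {}GL := spread _ _ jm GL.
have GXY X Y i j : (i < m)%N -> (j < m)%N -> G (block i j X) ->
    G (block j j Y) -> G (block i j (X *m Y)).
  by move=> im' jm' GX GY; have := GM GX GY; rewrite (block_mul cb) // eqxx.
have Gblock i j X : (i < m)%N -> (j < m)%N -> G (block i j X).
  move=> im' jm'; have [x [y [z [t ->]]]] := mx2_span X.
  have G0 := gen0 GD (G1 i j im' jm').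
  rewrite -[t *: _]addr0 !block_linear.
  have block0 : block i j 0 = 0 by rewrite /block mulmx0 mul0mx.
  rewrite block0.
  by do ?[apply: GU|apply: GL|exact: G0|apply: GXY|apply: GD].
move=> X; rewrite (block_decomposition X bc1).
have [a Ga] : exists a, G a by exists (block i0 i0 1%:M); apply: G1.
by do 2![apply: gen_sum => [||?] //; first exact: gen0 Ga]; apply: Gblock.
Qed.

(** P_00 K P_00 is the upper nilpotent.  Once it is removed from K, the
    products with P_00 give P_01 and P_10, hence P_11, which in turn isolates
    the lower nilpotent and leaves the path operator. *)
Lemma path_nilpotents_generate : (1 < m)%N ->
  G (block 0 0 1%:M) ->
  G (path_op m b c + block 0 0 upper_nil + block 1 1 lower_nil) ->
  forall X, G X.
Proof.
move=> m1 G0; set K := path_op _ _ _ + _ + _ => GK.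
have m0 := ltnW m1; have pathr := path_opMr cb; have pathl := path_opMl cb.
set U := block 0 0 upper_nil in K GK *; set L := block 1 1 lower_nil in K GK *.
have KP0 : K *m block 0 0 1%:M = U - block 1 0 1%:M.
  rewrite !mulmxDl pathr // m1 !(block_mul cb) //= mulmx1.
  by rewrite sub0r addr0 addrC.
have GU : G U.
  have := GM G0 (GM GK G0); rewrite KP0 mulmxBr !(block_mul cb) //=.
  by rewrite mul1mx subr0.
have GPL : G (path_op m b c + L).
  by have := genB GD GK GU; rewrite /K addrAC addrK.
have G10 : G (block 1 0 1%:M).
  rewrite -[block _ _ _](subKr U); apply: genB => //; rewrite -KP0.
  exact: GM.
have G01 : G (block 0 1 1%:M).
  have := GM G0 GPL; rewrite mulmxDr pathl // m1 (block_mul cb) //=.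
  by rewrite subr0 addr0.
have G11 : G (block 1 1 1%:M).
  by have := GM G10 G01; rewrite (block_mul cb) //= mul1mx.
have GL : G L.
  have := GM (GM G11 GPL) G11; rewrite mulmxDr pathl //.
  rewrite mulmxDl mulmxBl !(block_mul cb) //= mul1mx mulmx1 subr0.
  suff -> : (if (2 < m)%N then block 1 2 1%:M else 0) *m block 1 1 1%:M = 0.
    by rewrite add0r.
  by case: ifP => [m2|_]; rewrite ?mul0mx // (block_mul cb).
have GP : G (path_op m b c) by rewrite -(addrK L (path_op m b c)); apply: genB.
exact: (nilpotents_generate m0 m1 (path_generates cb GD GM GP G0) GU GL).
Qed.

End BlockGeneration.

(** * The algebra generated by a tuple and its adjoints *)

Section GeneratedAlgebra.
Variables (k : closedFieldType) (n r : nat) (rho : 'M[k]_n -> 'M[k]_n).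
Implicit Types (A : endo_tuple k n r).

Definition letter A (x : 'I_r + 'I_r) : 'M[k]_n :=
  match x with inl i => A i | inr i => rho (A i) end.

Definition word A (w : seq ('I_r + 'I_r)) : 'M[k]_n :=
  \prod_(x <- w) letter A x.

Definition generated A X := exists p, X = nceval rho A p.

(** Two noncommutative polynomials have different supports; evaluating both on
    a common support is what makes the evaluation additive. *)
Lemma nceval_dom A (d : {fset {fmonom ('I_r + 'I_r)%type}}) (p : ncpoly k r) :
  (monalg.msupp p `<=` d)%fset ->
  nceval rho A p = \sum_(w <- d) monalg.mcoeff w p *: word A w.
Proof.
move=> sub; apply: big_fset_incl => // w _ /monalg.mcoeff_outdom ->.
by rewrite scale0r.
Qed.

Lemma nceval_linear A a (p q : ncpoly k r) :
  nceval rho A (a *: p + q) = a *: nceval rho A p + nceval rho A q.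
Proof.
pose d := (monalg.msupp p `|` monalg.msupp q)%fset.
have sub : (monalg.msupp (a *: p + q) `<=` d)%fset.
  apply: fsubset_trans (monalg.msuppD_le _ _) _.
  exact/fsetSU/monalg.msuppZ_le.
rewrite (nceval_dom _ sub) (nceval_dom _ (fsubsetUl _ _ : _ `<=` d)%fset).
rewrite (nceval_dom _ (fsubsetUr _ _ : _ `<=` d)%fset).
rewrite scaler_sumr -big_split; apply: eq_bigr => w _ /=.
by rewrite monalg.mcoeffD monalg.mcoeffZ scalerDl scalerA.
Qed.

Lemma generatedP A a X Y :
  generated A X -> generated A Y -> generated A (a *: X + Y).
Proof. by move=> [p ->] [q ->]; exists (a *: p + q); rewrite nceval_linear. Qed.

Lemma generated_word A w : generated A (word A w).
Proof.
exists (monalg.mkmalgU (FMonom w) 1).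
by rewrite /nceval monalg.msuppU oner_eq0 big_seq_fset1 monalg.mcoeffUU scale1r.
Qed.

Lemma generated0 A : generated A 0.
Proof. exact: (gen0 (@generatedP A) (generated_word A [::])). Qed.

Lemma generatedM A X Y :
  generated A X -> generated A Y -> generated A (X *m Y).
Proof.
have combE p : nceval rho A p = \sum_(w <- monalg.msupp p)
    (monalg.mcoeff w p *: word A w) by [].
have gen_comb (T : Type) (s : seq T) c F : (forall w, generated A (F w)) ->
    generated A (\sum_(w <- s) c w *: F w).
  move=> GF; elim/big_ind: _ => [|*|w _]; first exact: generated0.
    exact: (genD (@generatedP A)).
  by rewrite -[_ *: _]addr0; apply: generatedP => //; apply: generated0.
move=> [p ->] [q ->]; rewrite !combE mulmx_suml.
under eq_bigr do rewrite -scalemxAl.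
apply: (gen_comb _) => v; rewrite mulmx_sumr.
under eq_bigr do rewrite -scalemxAr.
apply: gen_comb => w; have := generated_word A (v ++ w).
by rewrite /word big_cat.
Qed.

(** The n^2 words chosen by W, flattened into the rows of a square matrix. *)
Definition word_mx A (W : 'I_(n * n) -> seq ('I_r + 'I_r)) :=
  \matrix_t mxvec (word A (W t)).

(** The n^2 matrix units involve finitely many words, whose span is everything;
    a maximal independent subfamily has n^2 members. *)
Lemma generatesP A :
  generates rho A <-> exists W, \det (word_mx A W) != 0.
Proof.
split=> [gen|[W]]; last first.
  rewrite -unitfE -unitmxE => uW B.
  rewrite -[B]mxvecK -[mxvec B](mulmxKV uW) mulmx_sum_row raddf_sum.
  rewrite -/(generated A _); elim/big_ind: _ => [|*|t _].
  - exact: generated0.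
  - exact: (genD (@generatedP A)).
  - rewrite /= linearZ rowK /= mxvecK -[_ *: _]addr0.
    by apply: generatedP; [apply: generated_word|apply: generated0].
have [p pE] := choice gen.
pose words : seq {fmonom ('I_r + 'I_r)%type} :=
  flatten [seq (monalg.msupp (p (delta_mx ij.1 ij.2)) : seq _) |
            ij <- enum (('I_n * 'I_n)%type : finType)].
pose M := \matrix_(t < size words) mxvec (word A (nth (FMonom [::]) words t)).
have fullM : row_full M.
  rewrite -sub1mx; apply/row_subP=> ij; rewrite row1.
  case/mxvec_indexP: ij => i j; rewrite -mxvec_delta (pE (delta_mx i j)).
  rewrite /nceval raddf_sum big_seq; apply: summx_sub => w wp.
  rewrite /= linearZ scalemx_sub // -/(word A w).
  have wW : w \in words.
    by apply/flatten_mapP; exists (i, j); rewrite ?mem_enum.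
  have tW : (index w words < size words)%N by rewrite index_mem.
  by have := row_sub (Ordinal tW) M; rewrite rowK /= nth_index.
pose W t := fmonom_val (nth (FMonom [::]) words (fullrankfun fullM t)).
exists W.
have := fullrowsub_unit fullM; rewrite unitmxE unitfE.
suff -> : rowsub (fullrankfun fullM) M = word_mx A W by [].
by apply/row_matrixP => t; rewrite row_rowsub !rowK.
Qed.

End GeneratedAlgebra.

(** * Zariski topology: openness and irreducibility *)

Section ZariskiTopology.
Local Open Scope classical_set_scope.
Variables (k : closedFieldType) (n r : nat).
Implicit Types (A B : endo_tuple k n r).
Local Notation poly := (mpoly.mpoly (r * (n * n)) k).

Lemma coordsE A (i : 'I_r) (a b : 'I_n) :
  coords A (mxvec_index i (mxvec_index a b)) = A i a b.
Proof. by rewrite /coords mxvecE mxE mxvecE. Qed.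

(** Principal open sets form a basis. *)
Lemma zariski_openP (O : set (endo_tuple k n r)) :
  open O <-> forall A, O A -> exists p : poly, p.@[coords A] != 0 /\
     (forall B, p.@[coords B] != 0 -> O B).
Proof.
rewrite openE_zariski; split=> [[I ->] A|Op].
  move=> /existsNP[p /not_implyP[Ip /eqP pA]]; exists p; split=> // B pB.
  by move=> /(_ p Ip) /eqP; apply/negP.
exists [set p | forall B, p.@[coords B] != 0 -> O B].
apply/seteqP; split=> A /=.
  by move=> /Op[p [pA pO]] /(_ p pO) /eqP; apply/negP.
by move=> /existsNP[p /not_implyP[pO /eqP pA]]; apply: pO.
Qed.

Definition line A B (t : k) : endo_tuple k n r :=
  [ffun i => A i + t *: (B i - A i)].

Lemma coords_line A B t j :
  coords (line A B t) j = coords A j + t * (coords B j - coords A j).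
Proof.
by case/mxvec_indexP: j => i ab; case/mxvec_indexP: ab => a b;
  rewrite !coordsE ffunE !mxE.
Qed.

Lemma poly_on_line (p : poly) A B :
  exists q : {poly k}, forall t, q.[t] = p.@[coords (line A B t)].
Proof.
pose h j := (coords A j)%:P + 'X * (coords B j - coords A j)%:P.
exists (\sum_(m <- msupp p) (p@_m)%:P * \prod_(i < r * (n * n)) h i ^+ m i).
move=> t; rewrite horner_sum mevalE; apply: eq_bigr => m _.
rewrite hornerM hornerC horner_prod; congr (_ * _); apply: eq_bigr => i _.
by rewrite horner_exp coords_line !hornerE.
Qed.

(** On the line through a point of O1 and a point of O2, the two defining
    polynomials are nonzero, and an algebraically closed field is infinite, so
    some point of the line avoids the roots of both. *)
Lemma zariski_irreducible (O1 O2 : set (endo_tuple k n r)) :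
  open O1 -> O1 !=set0 -> open O2 -> O2 !=set0 -> O1 `&` O2 !=set0.
Proof.
move=> /zariski_openP op1 [A /op1 [p [pA pO]]].
move=> /zariski_openP op2 [B /op2 [q [qB qO]]].
have [P PE] := poly_on_line p A B; have [Q QE] := poly_on_line q A B.
have line0 : line A B 0 = A.
  by apply/ffunP=> i; rewrite ffunE scale0r addr0.
have line1 : line A B 1 = B.
  by apply/ffunP=> i; rewrite ffunE scale1r addrC subrK.
have nzP : P != 0 by apply: contraNneq pA => P0; rewrite -line0 -PE P0 horner0.
have nzQ : Q != 0 by apply: contraNneq qB => Q0; rewrite -line1 -QE Q0 horner0.
have /closed_nonrootP[t] : P * Q != 0 by rewrite mulf_neq0.
rewrite rootE hornerM mulf_eq0 PE QE negb_or => /andP[pt qt].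
by exists (line A B t); split; [apply: pO|apply: qO].
Qed.

Variable rho : 'M[k]_n -> 'M[k]_n.
Hypothesis rho_linear : linear rho.

(** The letters of the generic tuple, whose entries are the variables; for a
    letter rho(A_i) the entries are linear forms, by linearity of rho. *)
Definition generic_letter (x : 'I_r + 'I_r) : 'M[poly]_n :=
  match x with
  | inl i => \matrix_(a, b) 'X_(mxvec_index i (mxvec_index a b))
  | inr i => \matrix_(a, b) \sum_c \sum_d
      'X_(mxvec_index i (mxvec_index c d)) * (rho (delta_mx c d) a b)%:MP
  end.

Lemma rho_entries X : rho X = \sum_c \sum_d X c d *: rho (delta_mx c d).
Proof.
pose rhoL : {linear 'M[k]_n -> 'M[k]_n} :=
  HB.pack rho (GRing.isLinear.Build _ _ _ _ rho rho_linear).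
rewrite {1}[X]matrix_sum_delta -[rho]/(rhoL : _ -> _).
by rewrite linear_sum; apply: eq_bigr => c _; rewrite linear_sum;
  apply: eq_bigr => d _; rewrite linearZ.
Qed.

Lemma generic_letterE A x :
  map_mx (meval (coords A)) (generic_letter x) = letter rho A x.
Proof.
case: x => i; apply/matrixP => a b; rewrite !mxE.
  by rewrite mevalXU coordsE.
rewrite [letter _ _ _]/= rho_entries summxE raddf_sum; apply: eq_bigr => c _.
rewrite summxE raddf_sum; apply: eq_bigr => d _.
by rewrite /= mevalM mevalXU mevalC coordsE mxE.
Qed.

Lemma word_polynomial W : exists p : poly,
  forall A, p.@[coords A] = \det (word_mx rho A W).
Proof.
exists (\det (\matrix_t mxvec (\prod_(x <- W t) generic_letter x))) => A.
rewrite -det_map_mx; congr (\det _); apply/matrixP => t ab.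
rewrite !mxE; case/mxvec_indexP: ab => a b; rewrite !mxvecE.
have -> : word rho A (W t) =
    map_mx (meval (coords A)) (\prod_(x <- W t) generic_letter x).
  rewrite /word; elim: (W t) => [|x w IH]; first by rewrite !big_nil map_mx1.
  by rewrite !big_cons map_mxM IH generic_letterE.
by rewrite mxE.
Qed.

Lemma open_U : open (U r rho).
Proof.
apply/zariski_openP => A /generatesP[W detW]; have [p pE] := word_polynomial W.
exists p; split=> [|B]; rewrite pE // => detB.
by apply/generatesP; exists W.
Qed.

End ZariskiTopology.

(** * A generating tuple *)

Section AdjointOfBlocks.
Variables (k : closedFieldType) (n r : nat) (form : {skew_symmetric 'cV[k]_n}).
Hypothesis (hform : nondegenerate form).
Variable rho : 'M[k]_n -> 'M[k]_n.
Hypothesis hrho : adjoint_involution form rho.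
Variables (e f : nat -> 'cV[k]_n).

Local Notation b := (frame e f).
Local Notation c := (coframe form e f).

Lemma block_1E i j :
  block b c i j 1%:M = rank1 form (f i) (e j) - rank1 form (e i) (f j).
Proof. by rewrite /block mulmx1 /frame mul_row_col mulmxN addrC. Qed.

Lemma block_upperE i : block b c i i (upper_nil k) = rank1 form (e i) (e i).
Proof.
rewrite /block /frame mul_row_block !mulmx0 mulmx1 add0r mul_row_col.
by rewrite mul0mx addr0 add0r.
Qed.

Lemma block_lowerE i : block b c i i (lower_nil k) = - rank1 form (f i) (f i).
Proof.
rewrite /block /frame mul_row_block !mulmx0 mulmx1 addr0 add0r mul_row_col.
by rewrite mul0mx addr0 mulmxN.
Qed.

Let rhoD := adjointD hform hrho.
Let rhoN := adjointN hform hrho.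
Let rho_rank1 := adjoint_rank1 hform hrho.

Lemma rho_block1 i j : rho (block b c i j 1%:M) = block b c j i 1%:M.
Proof.
by rewrite !block_1E rhoD rhoN !rho_rank1 opprK addrC.
Qed.

Lemma rho_block_upper i :
  rho (block b c i i (upper_nil k)) = - block b c i i (upper_nil k).
Proof. by rewrite block_upperE rho_rank1. Qed.

Lemma rho_block_lower i :
  rho (block b c i i (lower_nil k)) = - block b c i i (lower_nil k).
Proof. by rewrite block_lowerE rhoN rho_rank1. Qed.

Lemma rho_path m : rho (path_op m b c) = - path_op m b c.
Proof.
rewrite /path_op -sumrN; elim/big_rec2: _ => [|i Y X _ <-]; last first.
  by rewrite !rhoD rhoN !rho_block1 opprB addrC.
by rewrite (adjoint0 hform hrho).
Qed.
End AdjointOfBlocks.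

(** One endomorphism S + K suffices when V has at least two hyperbolic planes;
    a single plane needs the two nilpotents as separate entries. *)
Lemma generating_tuple (k : closedFieldType) (n r : nat)
    (form : {skew_symmetric 'cV[k]_n}) (rho : 'M[k]_n -> 'M[k]_n) :
  2%N \notin [pchar k] -> (0 < n)%N -> (0 < r)%N -> nondegenerate form ->
  adjoint_involution form rho -> ~ (n = 2%N /\ r = 1%N) ->
  exists A : endo_tuple k n r, U r rho A.
Proof.
move=> hk n0 r0 hform hrho n2r1.
have [m [e [f [fam full]]]] := symplectic_basis hk hform.
have cb i j (im : (i < m)%N) (jm : (j < m)%N) := coframeK fam im jm.
pose b := frame e f; pose c := coframe form e f.
have m0 : (0 < m)%N.
  rewrite lt0n; apply/negP => /eqP m0; move: full.
  rewrite /frame_sum m0 big_ord0 => /matrixP/(_ (Ordinal n0) (Ordinal n0))/eqP.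
  by rewrite !mxE eqxx eq_sym oner_eq0.
have gen_letter (A : endo_tuple k n r) x : generated rho A (letter rho A x).
  by have := generated_word rho A [:: x]; rewrite /word big_seq1.
have [m1|] := ltnP 1 m.
  pose S := block b c 0 0 1%:M.
  pose K := path_op m b c + block b c 0 0 (upper_nil k)
            + block b c 1 1 (lower_nil k).
  have rhoK : rho K = - K.
    rewrite /K !(adjointD hform hrho) (rho_path hform hrho).
    by rewrite (rho_block_upper hform hrho) (rho_block_lower hform hrho)
               -!opprD.
  have rhoSK : rho (S + K) = S - K.
    by rewrite (adjointD hform hrho) (rho_block1 hform hrho) rhoK.
  exists [ffun _ => S + K] => B; set A := [ffun _ => _].
  have GD := @generatedP k n r rho A; have GM := @generatedM k n r rho A.
  have GSK : generated rho A (S + K).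
    by have := gen_letter A (inl (Ordinal r0)); rewrite /= ffunE.
  have GSmK : generated rho A (S - K).
    by have := gen_letter A (inr (Ordinal r0)); rewrite /= ffunE rhoSK.
  (* S is the self-adjoint part of S + K. *)
  have GS : generated rho A S.
    have two : 2%:R != 0 :> k by move: hk; rewrite inE.
    have -> : S = 2%:R^-1 *: ((S + K) + (S - K)) + 0.
      by rewrite addrACA subrr !addr0 -mulr2n -scaler_nat scalerA mulVf
                 ?scale1r.
    exact: GD (genD GD GSK GSmK) (generated0 _ _).
  have GK : generated rho A K by have := genB GD GSK GS; rewrite addrC addKr.
  exact: (path_nilpotents_generate cb full GD GM m1 GS GK).
rewrite leq_eqVlt ltnS leqNgt m0 orbF => /eqP m1.
(* With a single plane, frame and coframe are inverse to each other, so
   n = 2. *)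
have bc1 : b 0 *m c 0 = 1%:M by move: full; rewrite /frame_sum m1 big_ord1.
have n2 : n = 2%N.
  apply/eqP; rewrite eqn_leq (mulmx1_min bc1) /=.
  by have := cb _ _ m0 m0; rewrite eqxx => /mulmx1_min.
have r1 : (1 < r)%N.
  by rewrite ltn_neqAle r0 andbT; apply/eqP => r1; apply: n2r1; rewrite n2 -r1.
exists [ffun i => if i == Ordinal r0 then block b c 0 0 (upper_nil k)
                  else block b c 0 0 (lower_nil k)] => B.
set A := [ffun _ => _].
have GD := @generatedP k n r rho A; have GM := @generatedM k n r rho A.
have GU : generated rho A (block b c 0 0 (upper_nil k)).
  by have := gen_letter A (inl (Ordinal r0)); rewrite /= ffunE eqxx.
have GL : generated rho A (block b c 0 0 (lower_nil k)).
  by have := gen_letter A (inl (Ordinal r1)); rewrite /= ffunE.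
apply: (nilpotents_generate cb full GD GM m0 m0 _ GU GL).
move=> i j; rewrite m1 !ltnS !leqn0 => /eqP-> /eqP->.
(* The identity block is N N' + N' N. *)
have := genD GD (GM _ _ GU GL) (GM _ _ GL GU).
rewrite !(block_mul cb) // !eqxx one_upper_lower.
by rewrite /block mulmxDr mulmxDl.
Qed.

Theorem corollary4p15 (k : closedFieldType) (hk : 2%N \notin [pchar k])
    (n r : nat) (hn : (0 < n)%N) (hr : (0 < r)%N)
    (form : {skew_symmetric 'cV[k]_n}) (hform : nondegenerate form)
    (rho : 'M[k]_n -> 'M[k]_n) (hrho : adjoint_involution form rho) :
  ~ (n = 2%N /\ r = 1%N) -> open (U r rho) /\ dense (U r rho).
Proof.
move=> n2r1; have openU := open_U r (adjoint_linear hform hrho).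
split=> // O O0 openO; apply: zariski_irreducible => //.
exact: (generating_tuple hk hn hr hform hrho n2r1).
Qed.
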